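(* For any Kripke model $\mathcal{M}$ and any generalized event model $\mathcal{E}$ such that $\mathcal{M}\otimes\mathcal{E}$ has a non-empty set of worlds (i.e. is a Kripke model), $\mathcal{M}\otimes\mathcal{E}$ is a simulation of a refinement of $\mathcal{M}$; that is, there exists a Kripke model $\mathcal{M}'$ such that $\mathcal{M}'$ is a refinement of $\mathcal{M}$ and $\mathcal{M}\otimes\mathcal{E}$ is a simulation of $\mathcal{M}'$.
   Context: Language. $At$ is a countable set of atoms, $Ag$ a finite set of agents. The language $\mathcal{L}_{DEL}$ and generalized event models are defined by simultaneous recursion: $\varphi::=\top\mid p\mid\neg\varphi\mid\varphi\wedge\varphi\mid B_a\varphi\mid[\mathcal{E},e]\varphi\mid\forall\varphi$, with $p\in At$, $a\in Ag$, $\mathcal{E}$ a generalized event model and $e$ an event in it. A generalized event model is $\mathcal{E}=(E,Q,Q^+,pre)$ with $E$ a non-empty finite set, $Q_a,Q_a^+\subseteq E\times E$ for each $a\in Ag$, and $pre:E\to\mathcal{L}_{DEL}$. $Q_a(e)=\{f:(e,f)\in Q_a\}$, $Q_a^+(e)=\{f:(e,f)\in Q_a^+\}$. Semantics. A Kripke model is $\mathcal{M}=(W,R,V)$ with $W\neq\emptyset$, $R_a\subseteq W\times W$ arbitrary for each $a\in Ag$, $V:At\to\wp(W)$; $R_a(w)=\{v:(w,v)\in R_a\}$. Atoms and Booleans are standard; $\mathcal{M},w\vDash B_a\varphi$ iff $\mathcal{M},v\vDash\varphi$ for all $v\in R_a(w)$; $\mathcal{M},w\vDash\forall\varphi$ iff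 $\mathcal{M},v\vDash\varphi$ for all $v\in W$; $\mathcal{M},w\vDash[\mathcal{E},e]\varphi$ iff: if $\mathcal{M},w\vDash pre(e)$ then $\mathcal{M}\otimes\mathcal{E},(w,e)\vDash\varphi$. The generalized product update is $\mathcal{M}\otimes\mathcal{E}=(W^{\mathcal E},R^{\mathcal E},V^{\mathcal E})$ with $W^{\mathcal E}=\{(w,e)\in W\times E:\mathcal{M},w\vDash pre(e)\}$; for $(w,e),(v,f)\in W^{\mathcal E}$, $(v,f)\in R_a^{\mathcal E}(w,e)$ iff either $f\in Q_a^+(e)$, or $v\in R_a(w)$ and $f\in Q_a(e)$; $V^{\mathcal E}(p)=\{(w,e)\in W^{\mathcal E}:w\in V(p)\}$. Refinement and simulation. Let $\mathcal{M}=(W,R,V)$ and $\mathcal{M}'=(W',R',V')$ be Kripke models and $Z\subseteq W\times W'$ a non-empty relation. Consider the conditions, for all $(w,w')\in Z$ and $a\in Ag$: (Atom) $w\in V(p)$ iff $w'\in V'(p)$, for all $p\in At$; (Forth) if $v\in R_a(w)$ then there is $v'\in R'_a(w')$ with $(v,v')\in Z$; (Back) if $v'\in R'_a(w')$ then there is $v\in R_a(w)$ with $(v,v')\in Z$. $\mathcal{M}'$ is a refinement of $\mathcal{M}$ if there is such a $Z$ satisfying Atom and Back; $\mathcal{M}'$ is a simulation of $\mathcal{M}$ if there is such a $Z$ satisfying Atom and Forth. *)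

(* Defs.v *)
From HB Require Import structures.
From mathcomp Require Import all_boot.

Set Implicit Arguments.
Unset Strict Implicit.
Unset Printing Implicit Defensive.

(* A generalized event model on the event set [E], with preconditions in [F].
   The set of formulas is a parameter so that [form] below can be defined by
   nested recursion through this record. *)
Record event_model (Ag E : finType) (F : Type) := EventModel {
  evrel : Ag -> rel E;                      (* Q_a   *)
  evrel_plus : Ag -> rel E;                 (* Q_a^+ *)
  pre : E -> F;
  events_nonempty : inhabited E
}.

Inductive form (At : countType) (Ag : finType) : Type :=
| FTop
| FAtom of At
| FNeg of form At Ag
| FAnd of form At Ag & form At Ag
| FBel of Ag & form At Ag
| FUpd (E : finType) of event_model Ag E (form At Ag) & E & form At Ag
| FAll of form At Ag.

Notation gen_event_model At Ag E := (event_model Ag E (form At Ag)).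

Record kripke (At : countType) (Ag : finType) := Kripke {
  world : Type;
  acc : Ag -> world -> world -> Prop;
  valuation : At -> world -> Prop;
  worlds_nonempty : inhabited world
}.

Section Update.
Variables (At : countType) (Ag : finType).

(* The product is first defined relative to an arbitrary interpretation
   [S e w] of "w satisfies pre(e)"; [update] takes [S] to be satisfaction.
   A product is a Kripke model only when it has a world, hence the argument
   [ne]. *)
Definition product_world (W E : Type) (S : E -> W -> Prop) : Type :=
  {x : W * E | S x.2 x.1}.

Definition product (M : kripke At Ag) (E : finType) (F : Type)
    (m : event_model Ag E F) (S : E -> world M -> Prop)
    (ne : inhabited (product_world S)) : kripke At Ag :=
  {| world := product_world S;
     acc := fun a x y =>
       let: (w, e) := sval x in
       let: (v, f) := sval y in
       evrel_plus m a e f \/ (acc a w v /\ evrel m a e f);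
     valuation := fun p x => valuation p (sval x).1;
     worlds_nonempty := ne |}.

Fixpoint sat (M : kripke At Ag) (phi : form At Ag) : world M -> Prop :=
  match phi with
  | FTop => fun _ => True
  | FAtom p => fun w => valuation p w
  | FNeg psi => fun w => ~ sat psi w
  | FAnd psi chi => fun w => sat psi w /\ sat chi w
  | FBel a psi => fun w => forall v, acc a w v -> sat psi v
  | FUpd E m e psi => fun w =>
      let S := fun f v => sat (M := M) (pre m f) v in
      forall h : S e w,
        let x : product_world S := exist _ (w, e) h in
        sat (M := product m (inhabits x)) psi x
  | FAll psi => fun _ => forall v : world M, sat psi v
  end.

Definition update_world (M : kripke At Ag) (E : finType)
    (m : gen_event_model At Ag E) : Type :=
  product_world (fun e (w : world M) => sat (pre m e) w).

Definition update (M : kripke At Ag) (E : finType)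
    (m : gen_event_model At Ag E) (ne : inhabited (update_world M m)) :
    kripke At Ag :=
  product m ne.

Section Relations.
Variables M M' : kripke At Ag.
Implicit Type Z : world M -> world M' -> Prop.

Definition rel_nonempty Z := exists w w', Z w w'.

Definition atom_cond Z :=
  forall w w', Z w w' -> forall p : At, valuation p w <-> valuation p w'.

Definition forth_cond Z :=
  forall w w', Z w w' -> forall (a : Ag) v, acc a w v ->
  exists2 v', acc a w' v' & Z v v'.

Definition back_cond Z :=
  forall w w', Z w w' -> forall (a : Ag) v', acc a w' v' ->
  exists2 v, acc a w v & Z v v'.

End Relations.

Definition refinement_of (M' M : kripke At Ag) : Prop :=
  exists Z : world M -> world M' -> Prop,
    [/\ rel_nonempty Z, atom_cond Z & back_cond Z].

Definition simulation_of (M' M : kripke At Ag) : Prop :=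
  exists Z : world M -> world M' -> Prop,
    [/\ rel_nonempty Z, atom_cond Z & forth_cond Z].

End Update.

(* Main.v *)
(* Let M' be the update of M by the event model with all Q^+ arrows removed.
   Every arrow of M' projects to an arrow of M, so the projection witnesses
   refinement.  M' has the same worlds as the full update and fewer arrows, so
   the identity witnesses simulation. *)
Require Import Defs.
From mathcomp Require Import all_boot.

(** Since [pre] is kept, [update_world M (drop_plus m)] and [update_world M m] are convertible: one
    [ne] serves both updates, and their worlds can be compared by [=]. *)
Definition drop_plus {At : countType} {Ag E : finType}
    (m : gen_event_model At Ag E) : gen_event_model At Ag E :=
  {| evrel := evrel m;
     evrel_plus := fun _ _ _ => false;
     pre := pre m;
     events_nonempty := events_nonempty m |}.

Lemma update_drop_plus_refinement (At : countType) (Ag : finType)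
    (M : kripke At Ag) (E : finType) (m : gen_event_model At Ag E)
    (ne : inhabited (update_world M (drop_plus m))) :
  refinement_of (update ne) M.
Proof.
exists (fun w x => w = (sval x).1); split.
- by case: (ne) => x; exists (sval x).1, x.
- by move=> _ x -> p.
(* The [evrel_plus] disjunct is [false], so the arrow carries an arrow [wv] of [M]. *)
- move=> _ [[w e] h] -> a [[v f] k] /= [] // [wv _].
  by exists v.
Qed.

Lemma update_simulation_drop_plus (At : countType) (Ag : finType)
    (M : kripke At Ag) (E : finType) (m : gen_event_model At Ag E)
    (ne : inhabited (update_world M m)) :
  simulation_of (update ne) (@update _ _ M E (drop_plus m) ne).
Proof.
exists (fun x y => x = y); split.
- by case: (ne) => x; exists x, x.
- by move=> x _ <- p.
- move=> [[w e] h] _ <- a [[v f] k] /= [] // wv.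
  (* Reusing the proof [k] gives the very same world; [wv] is the ordinary disjunct of the full
     update. *)
  by exists (exist _ (v, f) k) => //; right.
Qed.

Theorem theorem7p8 (At : countType) (Ag : finType) (M : kripke At Ag)
    (E : finType) (m : gen_event_model At Ag E)
    (ne : inhabited (update_world M m)) :
  exists M' : kripke At Ag,
    refinement_of M' M /\ simulation_of (update ne) M'.
Proof.
exists (@update _ _ M E (drop_plus m) ne); split.
  exact: update_drop_plus_refinement.
exact: update_simulation_drop_plus.
Qed.
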